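(* Let $G$ be a group and $N$ a normal subgroup of $G$ such that the exact sequence $1\to N\to G\to G/N\to1$ virtually splits. Then for every $G$-invariant homogeneous quasimorphism $f$ on $N$, there exists a quasimorphism $f'$ on $G$ such that $f'|_N=f$ and $D(f')\le D(f)$.
   Context: A short exact sequence $1\to N\to G\xrightarrow{q}Q\to1$ virtually splits if there exist a finite-index subgroup $\Lambda\le Q$ and a homomorphism $s\colon\Lambda\to G$ with $q\circ s=\mathrm{id}_\Lambda$. For a group $H$, a function $f\colon H\to\mathbb{R}$ is a quasimorphism if its defect $D(f)=\sup_{a,b\in H}|f(ab)-f(a)-f(b)|$ is finite; it is homogeneous if $f(a^n)=nf(a)$ for all $a\in H$, $n\in\mathbb{Z}$. A function $f$ on $N$ is $G$-invariant if $f(gag^{-1})=f(a)$ for all $g\in G$, $a\in N$. *)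

(* Defs.v *)
From HB Require Import structures.
From mathcomp Require Import all_boot all_order all_algebra.
From mathcomp Require Import all_classical all_reals all_analysis.

Set Implicit Arguments.
Unset Strict Implicit.
Unset Printing Implicit Defensive.

HB.mixin Record isConjgClosed (G : groupType) (S : {pred G}) := {
  gpredJl : forall g, {in S, forall x, (g * x * g^-1)%g \in S}
}.

#[short(type="normalClosed")]
HB.structure Definition NormalClosed (G : groupType) :=
  {S of isConjgClosed G S & GroupClosed G S}.

(* Preservation of inverses follows from the two axioms of UMagmaMorphism. *)
Notation group_hom G H := (UMagmaMorphism.type G H).

Definition short_exact (N G Q : groupType)
    (i : group_hom N G) (q : group_hom G Q) : Prop :=
  [/\ injective i,
      forall x, q x = 1%g <-> exists a, i a = x &
      forall y, exists x, q x = y].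

Section Subgroup.
Local Open Scope group_scope.
Variables (G : groupType) (H : groupClosed G).

Record subgroup := Subgroup {
  subgroup_val : G;
  subgroup_valP : subgroup_val \in H
}.

HB.instance Definition _ := [isSub for subgroup_val].
HB.instance Definition _ := [Choice of subgroup by <:].

Lemma subgroup_group_closed : group_closed H.
Proof. by split; [exact: gpred1|exact: gpredF]. Qed.

HB.instance Definition _ :=
  SubChoice_isSubGroup.Build G _ subgroup subgroup_group_closed.

HB.instance Definition _ :=
  UMagmaMorphism.copy subgroup_val (val : subgroup -> G).

Definition finite_index : Prop :=
  finite_set (range (fun x : G => [set x * h | h in [set` H]]))%classic.

End Subgroup.

Section Quotient.
Local Open Scope group_scope.
Local Open Scope quotient_scope.
Variables (G : groupType) (N : normalClosed G).

Definition same_coset (x y : G) : bool := x^-1 * y \in N.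

Lemma same_coset_equiv : equiv_class_of same_coset.
Proof.
split=> [x|x y|y x z]; rewrite /same_coset.
- by rewrite mulVg gpred1.
- by rewrite -gpredV invgM invgK.
- by move=> xy yz; have := gpredM _ _ xy yz; rewrite mulgA mulgK.
Qed.

Canonical same_coset_equiv_rel := EquivRelPack same_coset_equiv.

Definition quotient_group := {eq_quot same_coset_equiv_rel}.

HB.instance Definition _ := Choice.on quotient_group.
HB.instance Definition _ := EqQuotient.on quotient_group.

Definition quotient_map (x : G) : quotient_group := \pi x.

Lemma quotient_mapP x y :
  quotient_map x = quotient_map y <-> x^-1 * y \in N.
Proof. by split=> [/eqmodP//|xy]; apply/eqmodP. Qed.

Definition quotient_one : quotient_group := quotient_map 1.
Definition quotient_inv (a : quotient_group) : quotient_group :=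
  quotient_map (repr a)^-1.
Definition quotient_mul (a b : quotient_group) : quotient_group :=
  quotient_map (repr a * repr b).

Lemma repr_quotient_map x : (repr (quotient_map x))^-1 * x \in N.
Proof. by apply/quotient_mapP; rewrite /quotient_map reprK. Qed.

Lemma quotient_mapM x y :
  quotient_map (x * y) = quotient_mul (quotient_map x) (quotient_map y).
Proof.
apply/esym/quotient_mapP.
have := gpredM _ _
  (gpredJl (repr (quotient_map y))^-1 _ (repr_quotient_map x))
  (repr_quotient_map y).
by rewrite !invgM invgK !mulgA mulgK.
Qed.

Lemma quotient_mapV x : quotient_map x^-1 = quotient_inv (quotient_map x).
Proof.
apply/quotient_mapP; rewrite invgK.
have := gpredJl x _ (repr_quotient_map x).
by rewrite !mulgA mulgK.
Qed.

Lemma quotient_ind (P : quotient_group -> Prop) :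
  (forall x, P (quotient_map x)) -> forall a, P a.
Proof. by move=> Pq a; rewrite -[a]reprK; exact: Pq. Qed.

Lemma quotient_mulA : associative quotient_mul.
Proof.
elim/quotient_ind=> x; elim/quotient_ind=> y; elim/quotient_ind=> z.
by rewrite -!quotient_mapM mulgA.
Qed.

Lemma quotient_mul1g : left_id quotient_one quotient_mul.
Proof. by elim/quotient_ind=> x; rewrite -quotient_mapM mul1g. Qed.

Lemma quotient_mulg1 : right_id quotient_one quotient_mul.
Proof. by elim/quotient_ind=> x; rewrite -quotient_mapM mulg1. Qed.

Lemma quotient_mulVg : left_inverse quotient_one quotient_inv quotient_mul.
Proof.
by elim/quotient_ind=> x; rewrite -quotient_mapV -quotient_mapM mulVg.
Qed.

Lemma quotient_mulgV : right_inverse quotient_one quotient_inv quotient_mul.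
Proof.
by elim/quotient_ind=> x; rewrite -quotient_mapV -quotient_mapM mulgV.
Qed.

HB.instance Definition _ := isGroup.Build quotient_group
  quotient_mulA quotient_mul1g quotient_mulg1 quotient_mulVg quotient_mulgV.

Lemma quotient_map_morphism : monoid_morphism quotient_map.
Proof. by split=> // x y; exact: quotient_mapM. Qed.

HB.instance Definition _ :=
  isUMagmaMorphism.Build G quotient_group quotient_map quotient_map_morphism.

Lemma quotient_short_exact :
  short_exact (@subgroup_val G N : group_hom _ _)
              (quotient_map : group_hom _ _).
Proof.
split=> [|x|y]; first exact: val_inj.
- have -> : 1 = quotient_map 1 :> quotient_group by [].
  split=> [/esym/quotient_mapP|[a <-]].
    by rewrite invg1 mul1g => xN; exists (Subgroup xN).
  by apply/esym/quotient_mapP; rewrite invg1 mul1g; exact: subgroup_valP.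
- by exists (repr y); exact: reprK.
Qed.

End Quotient.

(* Virtual splitting of a short exact sequence 1 -> N -> G -> Q -> 1;
   the condition only involves the projection q : G -> Q (see
   [quotient_short_exact] for the sequence 1 -> N -> G -> G/N -> 1). *)
Definition virtually_splits (G Q : groupType) (q : group_hom G Q) : Prop :=
  exists L : groupClosed Q, finite_index L /\
  exists s : group_hom (subgroup L) G, forall x, q (s x) = subgroup_val x.

Definition expgz (G : groupType) (x : G) (n : int) : G :=
  match n with
  | Posz m => (x ^+ m)%g
  | Negz m => (x ^- m.+1)%g
  end.

Section Quasimorphism.
Local Open Scope ring_scope.
Variables (R : realType) (H : groupType).

Definition defect (f : H -> R) : \bar R :=
  ereal_sup (range (fun p : H * H =>
    (`|f (p.1 * p.2)%g - f p.1 - f p.2|)%:E))%classic.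

Definition quasimorphism (f : H -> R) : Prop := defect f \is a fin_num.

Definition homogeneous (f : H -> R) : Prop :=
  forall (a : H) (n : int), f (expgz a n) = n%:~R * f a.

End Quasimorphism.

Section Invariance.
Local Open Scope group_scope.
Variables (G : groupType) (N : normalClosed G).

Definition normal_conj (g : G) (a : subgroup N) : subgroup N :=
  Subgroup (gpredJl g _ (subgroup_valP a)).

Definition conj_invariant (T : Type) (f : subgroup N -> T) : Prop :=
  forall g a, f (normal_conj g a) = f a.

End Invariance.

(* Main.v *)
(* Let L have finite index in Q = G/N and let s : L -> G be a section.
   Every x in the preimage K of L is uniquely s(l) a with a in N, and F(x) = f(a)
   extends f to K without increasing the defect, because
   s(l) a s(l') a' = s(l l') (s(l')^-1 a s(l')) a' and f is G-invariant.
   Averaging F over a left transversal (t_i) of K, i.e. taking the mean over i of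
   F(t_j^-1 g t_i) with g t_i in t_j K, then extends F to G: multiplication by g
   permutes the cosets, so the defect is again not increased, and on N the
   average is f by G-invariance. *)
From HB Require Import structures.
Require Import Defs.
From mathcomp Require Import finmap.
From mathcomp Require Import all_boot all_order all_algebra.
From mathcomp Require Import all_classical all_reals all_analysis.

Set Implicit Arguments.
Unset Strict Implicit.
Unset Printing Implicit Defensive.

Import Order.TTheory GRing.Theory Num.Theory.
Local Open Scope ring_scope.

Lemma defect_leP (R : realType) (H : groupType) (f : H -> R) (D : R) :
  (defect f <= D%:E)%E <->
  forall x y, `|f (x * y)%g - f x - f y| <= D.
Proof.
split=> [/ereal_supP fD x y|fD].
  by rewrite -lee_fin; apply: fD; exists (x, y).
by apply/ereal_supP => _ [p _ <-]; rewrite lee_fin.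
Qed.

(** The pair of identities witnesses it. With the value [-oo] excluded, a finite upper bound on a
    defect suffices for a quasimorphism. *)
Lemma defect_ge0 (R : realType) (H : groupType) (f : H -> R) :
  (0 <= defect f)%E.
Proof.
apply: (@le_trans _ _ (`|f (1 * 1)%g - f 1%g - f 1%g|)%:E).
  by rewrite lee_fin.
by apply: ereal_sup_ubound; exists (1%g, 1%g).
Qed.

Section Transversal.
Local Open Scope group_scope.
Local Open Scope classical_set_scope.

(** The index type is the finite set of left cosets itself: [t] chooses representatives and [c]
    sends a point to its coset. *)
Lemma finite_index_transversal (Q : groupType) (L : groupClosed Q) :
  finite_index L ->
  exists (I : finType) (t : I -> Q) (c : Q -> I),
    forall x i, c x = i <-> (t i)^-1 * x \in L.
Proof.
pose coset (x : Q) := [set x * h | h in [set` L]].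
have cosetP x y : coset x = coset y <-> y^-1 * x \in L.
  split=> [xy|yxL].
    have : coset x x by exists 1; rewrite ?mulg1//=; exact: gpred1.
    by rewrite xy => -[h hL <-]; rewrite mulKg.
  apply/seteqP; split=> _ [h hL <-].
    exists (y^-1 * x * h); last by rewrite !mulgA mulgV mul1g.
    exact: gpredM.
  exists (x^-1 * y * h); last by rewrite !mulgA mulgV mul1g.
  by apply: gpredM => //; rewrite -gpredV invgM invgK.
move=> finL; pose A := fset_set (range coset).
have cA x : coset x \in A by rewrite in_fset_set// inE; exists x.
have /choice[t tP] (i : A) : exists x, coset x = val i.
  have : val i \in A by exact: valP.
  by rewrite in_fset_set// inE => -[x _ <-]; exists x.
exists A, t, (fun x => [` cA x]%fset) => x i; rewrite -cosetP tP.
by split=> [<-//|xi]; apply: val_inj.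
Qed.

End Transversal.

Section Preimage.
Local Open Scope group_scope.
Variables (G Q : groupType) (q : group_hom G Q) (L : groupClosed Q).

Definition group_preim : {pred G} := [pred x | q x \in L].

Lemma group_preim1 : 1 \in group_preim.
Proof. by rewrite inE gmulf1 gpred1. Qed.

Lemma group_preimM : mulg_closed group_preim.
Proof. by move=> x y; rewrite !inE gmulfM; exact: gpredM. Qed.

Lemma group_preimV : invg_closed group_preim.
Proof. by move=> x; rewrite !inE gmulfV gpredV. Qed.

HB.instance Definition _ := isMulClosed.Build G group_preim group_preimM.
HB.instance Definition _ := isMul1Closed.Build G group_preim group_preim1.
HB.instance Definition _ := isInvClosed.Build G group_preim group_preimV.

End Preimage.

Section Transfer.
Variables (R : realType) (G : groupType) (K : groupClosed G).
Variables (I : finType) (t : I -> G) (c : G -> I).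
Hypothesis cP : forall x i, c x = i <-> ((t i)^-1 * x)%g \in K.

(** The cocycle of the group-theoretic transfer: the [k] with [g * t i = t j * k], where [j] indexes
    the coset of [g * t i]. *)
Definition transversal_cocycle (g : G) (i : I) : G :=
  ((t (c (g * t i)))^-1 * (g * t i))%g.

Definition transfer_mean (F : G -> R) (g : G) : R :=
  #|I|%:R^-1 * \sum_i F (transversal_cocycle g i).

Lemma transversal_cocycle_in g i : transversal_cocycle g i \in K.
Proof. exact/cP. Qed.

(** Left multiplication respects left cosets, and [x] and [t (c x)] share one. *)
Lemma coset_mulg g x : c (g * t (c x))%g = c (g * x)%g.
Proof.
apply/cP; rewrite -gpredV invgM invgK.
have -> : ((g * t (c x))^-1 * t (c (g * x)) =
  ((t (c x))^-1 * x) * ((t (c (g * x)))^-1 * (g * x))^-1)%g.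
  by rewrite !invgM !invgK !mulgA (mulgK x).
by apply: gpredF; exact/cP.
Qed.

Lemma coset_transversal i : c (t i) = i.
Proof. by apply/cP; rewrite mulVg gpred1. Qed.

Lemma coset_mulg_bij g : bijective (fun i => c (g * t i)%g).
Proof.
by exists (fun i => c (g^-1 * t i)%g) => i;
  rewrite coset_mulg ?mulKg ?mulVKg coset_transversal.
Qed.

Lemma transversal_cocycleM g h i :
  transversal_cocycle (g * h)%g i =
  (transversal_cocycle g (c (h * t i)) * transversal_cocycle h i)%g.
Proof.
by rewrite /transversal_cocycle coset_mulg !mulgA mulgK.
Qed.

Lemma transfer_mean_bound (F : G -> R) (D : R) :
    {in K &, forall x y, `|F (x * y)%g - F x - F y| <= D} ->
  forall g h, `|transfer_mean F (g * h)%g - transfer_mean F g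
                - transfer_mean F h| <= D.
Proof.
move=> FD g h; rewrite /transfer_mean.
(* Only the sum for [g] is reindexed, by the permutation that [h] induces on cosets. The cocycle
   identity then matches the three sums term by term, each term being a defect of [F] on [K]. *)
rewrite [X in _ - #|I|%:R^-1 * X - _](reindex _ (onW_bij _ (coset_mulg_bij h))).
rewrite -!mulrBr -!sumrB normrM ger0_norm ?invr_ge0 ?ler0n//.
have I0 : (0 < #|I|)%N by apply/card_gt0P; exists (c 1%g).
rewrite mulrC ler_pdivrMr ?ltr0n//.
apply: le_trans (ler_norm_sum _ _ _) _; rewrite mulr_natr -sumr_const.
apply: ler_sum => i _; rewrite transversal_cocycleM.
by apply: FD; exact: transversal_cocycle_in.
Qed.

Lemma transfer_mean_conj (F : G -> R) (x : G) (r : R) :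
    (forall g, (g^-1 * x * g)%g \in K) -> (forall g, F (g^-1 * x * g)%g = r) ->
  transfer_mean F x = r.
Proof.
move=> xK Fx; have I0 : (0 < #|I|)%N by apply/card_gt0P; exists (c 1%g).
rewrite /transfer_mean (eq_bigr (fun=> r)) => [|i _].
  by rewrite sumr_const -[r *+ _]mulr_natl mulKf// pnatr_eq0 -lt0n.
(* [x] fixes every coset, so its cocycle at [i] is the conjugate of [x] by [t i]. *)
have /cP ci : ((t i)^-1 * (x * t i))%g \in K by rewrite mulgA.
by rewrite /transversal_cocycle ci mulgA.
Qed.

End Transfer.

Section SectionExtension.
Variables (R : realType) (G : groupType) (N : normalClosed G).
Variables (L : groupClosed (quotient_group N)) (s : group_hom (subgroup L) G).
Hypothesis sK : forall l, quotient_map N (s l) = subgroup_val l.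
Variable f : subgroup N -> R.

(** The outer 0 is a default off the preimage of [L]; the inner one makes the expression total, as
    [(s l)^-1 * x] is in [N] once [s] is a section. *)
Definition section_extension (x : G) : R :=
  if (insub (quotient_map N x) : option (subgroup L)) is Some l then
    if (insub ((s l)^-1 * x)%g : option (subgroup N)) is Some a then f a else 0
  else 0.

Lemma quotient_map_val (a : subgroup N) : quotient_map N (val a) = 1%g.
Proof. by have [_ kerP _] := quotient_short_exact N; apply/kerP; exists a. Qed.

Lemma quotient_map_section l (a : subgroup N) :
  quotient_map N (s l * val a)%g = val l.
Proof. by rewrite gmulfM [X in (_ * X)%g]quotient_map_val mulg1; exact: sK. Qed.

(** The projection recovers [l], then cancelling [s l] recovers [a], so both [insub] succeed. *)
Lemma section_extensionE l a : section_extension (s l * val a)%g = f a.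
Proof.
by rewrite /section_extension quotient_map_section valK mulKg valK.
Qed.

Lemma section_decomp x :
  quotient_map N x \in L -> exists l (a : subgroup N), x = (s l * val a)%g.
Proof.
move=> xL; pose l : subgroup L := Subgroup xL.
have aN : ((s l)^-1 * x)%g \in N by apply/quotient_mapP; rewrite sK.
by exists l, (Subgroup aN); rewrite /= mulVKg.
Qed.

Lemma section_extension_val (a : subgroup N) : section_extension (val a) = f a.
Proof. by rewrite -[val a]mul1g -(gmulf1 (s := s)) section_extensionE. Qed.

Lemma section_extension_bound (D : R) :
    conj_invariant f -> (forall a b, `|f (a * b)%g - f a - f b| <= D) ->
  forall x y, quotient_map N x \in L -> quotient_map N y \in L ->
  `|section_extension (x * y)%g - section_extension x - section_extension y|
  <= D.
Proof.
move=> finv fD x y /section_decomp[l [a ->]] /section_decomp[m [b ->]].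
have -> : (s l * val a * (s m * val b) =
    s (l * m) * val (normal_conj (s m)^-1 a * b))%g.
  by rewrite !gmulfM /= invgK !mulgA mulgK.
(* Invariance turns [f a] into the value at the conjugate, leaving the defect of [f] at that
   conjugate and [b]. *)
by rewrite !section_extensionE -(finv (s m)^-1%g a).
Qed.

End SectionExtension.

Theorem proposition1p6 (R : realType) (G : groupType) (N : normalClosed G)
  (hsplit : virtually_splits (quotient_map N))
  (f : subgroup N -> R)
  (hquasi : quasimorphism f) (hhom : homogeneous f) (hinv : conj_invariant f) :
  exists f' : G -> R,
    [/\ quasimorphism f',
        (forall a : subgroup N, f' (subgroup_val a) = f a) &
        (defect f' <= defect f)%E].
Proof.
have [L [finL [s sK]]] := hsplit.
have [I [t [c cP]]] := finite_index_transversal finL.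
have [_ _ /choice[lift liftK]] := quotient_short_exact N.
pose q : group_hom G (quotient_group N) := quotient_map N.
pose K : groupClosed G := group_preim q L.
(* As [K] is the preimage of [L], lifts of coset representatives of [L] form a transversal of
   [K]. *)
have cK x i : c (q x) = i <-> ((lift (t i))^-1 * x)%g \in K.
  by rewrite inE gmulfM gmulfV liftK; exact: cP.
pose F := section_extension s f.
pose f' := transfer_mean (lift \o t) (c \o q) F.
have FD x y : `|f (x * y)%g - f x - f y| <= fine (defect f).
  by move: x y; apply/defect_leP; rewrite fineK.
have f'D : (defect f' <= defect f)%E.
  rewrite -(fineK hquasi); apply/defect_leP.
  apply: (transfer_mean_bound cK) => x y xK yK.
  by apply: (section_extension_bound sK).
exists f'; split=> //.
- rewrite /quasimorphism ge0_fin_numE ?defect_ge0//.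
  by apply: le_lt_trans f'D _; rewrite ltey_eq hquasi.
(* Conjugates of [a] project to 1, hence lie in [K]; there [F] is [f], constant on them by
   invariance. *)
- move=> a; apply: (transfer_mean_conj cK) => g.
    rewrite inE !gmulfM /= [_ (subgroup_val a)]quotient_map_val mulg1.
    by rewrite gmulfV mulVg gpred1.
  by rewrite -(hinv g^-1%g) -(section_extension_val sK) /= invgK.
Qed.
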